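(* For every $c>0$ and every sufficiently large integer $k$ (depending on $c$) there is a tree $T$ on $k$ vertices such that $r_{\mathrm{ind}}(T) \geq ck$.
   Context: The induced Ramsey number $r_{\mathrm{ind}}(H)$ of a graph $H$ is the minimum $n$ for which there is a graph $G$ with $n$ vertices such that for every $2$-edge-coloring of $G$ there is an induced subgraph of $G$ isomorphic to $H$ all of whose edges have the same color. *)

(* Defs.v *)
From HB Require Import structures.
From mathcomp Require Import all_boot all_order all_algebra.
From mathcomp Require Import reals.

Set Implicit Arguments.
Unset Strict Implicit.
Unset Printing Implicit Defensive.

Record sgraph := SGraph {
  vertex :> finType;
  adj : rel vertex;
  adj_sym : symmetric adj;
  adj_irrefl : irreflexive adj }.

Definition graph_connected (G : sgraph) : Prop :=
  forall x y : G, connect (@adj G) x y.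

(* In a simple graph a cycle has at least 3 vertices; the sequences x, y with
   x and y adjacent satisfy ucycle but are not cycles of the graph. *)
Definition graph_acyclic (G : sgraph) : Prop :=
  forall p : seq G, 2 < size p -> ~ ucycle (@adj G) p.

Definition is_tree (G : sgraph) : Prop :=
  [/\ 0 < #|G|, graph_connected G & graph_acyclic G].

Definition graph_iso (G H : sgraph) : Prop :=
  exists f : G -> H, bijective f /\ forall x y, adj (f x) (f y) = adj x y.

Section Induced.
Variables (G : sgraph) (S : {set G}).

Definition induced_adj : rel {x : G | x \in S} :=
  fun x y => adj (val x) (val y).

Lemma induced_sym : symmetric induced_adj.
Proof. by move=> x y; apply: adj_sym. Qed.

Lemma induced_irrefl : irreflexive induced_adj.
Proof. by move=> x; apply: adj_irrefl. Qed.

Definition induced_subgraph : sgraph := SGraph induced_sym induced_irrefl.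

End Induced.

(* A 2-edge-coloring of G is given by a map {set G} -> bool, of which only the
   values at the edges [set x; y], adj x y, are ever used. *)
Definition monochromatic_on (G : sgraph) (col : {set G} -> bool)
    (S : {set G}) : Prop :=
  exists b : bool, forall x y : G,
    x \in S -> y \in S -> adj x y -> col [set x; y] = b.

Definition induced_arrows (G H : sgraph) : Prop :=
  forall col : {set G} -> bool, exists S : {set G},
    graph_iso (induced_subgraph S) H /\ monochromatic_on col S.

(* "r is the induced Ramsey number of H": r is the minimum, in particular the
   set over which the minimum is taken is nonempty. *)
Definition is_induced_ramsey_number (H : sgraph) (r : nat) : Prop :=
  (exists G : sgraph, #|G| = r /\ induced_arrows G H) /\
  (forall G : sgraph, induced_arrows G H -> r <= #|G|).

(* Main.v *)
Require Import Defs.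
From HB Require Import structures.
From mathcomp Require Import all_boot all_order all_algebra.
From mathcomp Require Import reals boolp zify ring.

(** The tree is the spider: about k/2 legs of length 2 at a common centre, plus
    one pendant vertex at the centre when k is even.  It combines two features
    that a 2-colouring of a graph G with n < c k vertices can defeat at once: a
    vertex of linear degree, and an induced matching covering all vertices but
    the centre.

    Lower bound.  Suppose that a set B of o(n^2) edges meets every induced
    matching of G of linear size, even after o(n) of its edges are discarded.
    Call a vertex heavy if its B-degree is at least k/2; there are only o(n)
    heavy vertices.  Give one colour to the edges of B without heavy endpoint,
    and the other colour to all remaining edges.  A spider in the first colour
    would have a centre of B-degree at least k/2 that is not heavy.  A spider in
    the second colour would give an induced matching of linear size, and all its
    edges that belong to B would have a heavy endpoint; this is impossible, as
    only o(n) edges of a matching have one.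

    The set B comes from a one-sided variant of the regularity lemma
    ([regular_partition]).  Consider a partition of the vertices into
    cells and a set W of pairs of vertices, a union of products of cells, that
    contains few edges of G relative to its size.  A product of cells disjoint
    from W is irregular if the vertex set U of some induced matching has a
    positive proportion in both cells.  If the irregular products cover a
    positive proportion of all pairs, refine the partition by one such U for
    each of them and add to W the part of each irregular product that lies in
    U x U: as G[U] is a matching, this part contains few edges, and its size is
    a positive proportion of the product ([refine]).  Since W cannot outgrow the
    n^2 pairs, this ends after a bounded number of rounds, with a number of
    cells that depends only on the constants.  Then B consists of the edges in W
    or in irregular products.  For the vertex set U of any induced matching, all
    edges of G[U] outside B lose an endpoint once the vertices of U in cells
    where U is thin are dropped, and there are few of these.

    Existence of the Ramsey number.  Bipartite graphs without 4-cycles, such as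
    the incidence graph of points and lines of the affine plane over a finite
    field, contain no cycle of length below 6, and so every spider in them with
    legs of length 2 is induced.  By pigeonhole, a large plane has a colour and
    a point on many lines that have that colour at this point and at a second
    point ([rich_point]); these form a monochromatic spider. *)

Set Implicit Arguments.
Unset Strict Implicit.
Unset Printing Implicit Defensive.

Import Order.TTheory GRing.Theory Num.Theory.

(** * The spider *)

(** A vertex of maximal rank in a cycle has two distinct neighbours on the cycle,
    neither of them of larger rank. *)
Lemma acyclic_of_unique_lower_neighbour (G : sgraph) (rk : G -> nat) :
    (forall x y z : G, adj x y -> adj x z -> rk y <= rk x -> rk z <= rk x ->
      y = z) ->
  graph_acyclic G.
Proof.
move=> low p p_gt2 /andP[cyc_p uniq_p].
have [x0 x0p]: {x0 | x0 \in p} by case: p p_gt2 {cyc_p uniq_p} => // x0 p; exists x0; rewrite mem_head.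
case: (@arg_maxnP G x0 (mem p) rk x0p) => x xp x_max.
have [i s rot_p] := rot_to xp.
have cyc_s : cycle (@adj G) (x :: s) by rewrite -rot_p rot_cycle.
have uniq_s : uniq (x :: s) by rewrite -rot_p rot_uniq.
have size_s : 2 < size (x :: s) by rewrite -rot_p size_rot.
have le_x y : y \in x :: s -> rk y <= rk x.
  by rewrite -rot_p mem_rot => /x_max.
case: s => [|y [|z s]] // in cyc_s uniq_s size_s le_x {rot_p}.
have [xy lastx] : adj x y /\ adj (last z s) x.
  by move: cyc_s; rewrite /= rcons_path => /and3P[-> _ /andP[_ ->]].
have last_in : last z s \in z :: s by exact: mem_last.
have eq_y : y = last z s.
  apply: (low x) => //; first by rewrite adj_sym.
    by apply: le_x; rewrite !inE eqxx orbT.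
  by apply: le_x; rewrite in_cons [X in _ || X]in_cons last_in !orbT.
by move: uniq_s; rewrite /= -[_ && uniq s]/(uniq (z :: s)) eq_y last_in andbF.
Qed.

(** Vertex 0 is the centre, and each pair 2i+1, 2i+2 is a leg, with 2i+1 next to
    the centre. *)
Definition spider_parent (i j : nat) : bool :=
  (0 < i) && (j == if odd i then 0 else i.-1).

Definition spider_adj k : rel 'I_k :=
  fun i j => spider_parent i j || spider_parent j i.

Lemma spider_sym k : symmetric (@spider_adj k).
Proof. by move=> i j; rewrite /spider_adj orbC. Qed.

Lemma spider_irrefl k : irreflexive (@spider_adj k).
Proof.
by move=> i; rewrite /spider_adj orbb /spider_parent; case: ifP; lia.
Qed.

Definition spider k : sgraph := SGraph (@spider_sym k) (@spider_irrefl k).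

Lemma spider_is_tree k : 0 < k -> is_tree (spider k).
Proof.
case: k => // k _; split; first by rewrite card_ord.
- have to_root (i : spider k.+1) : connect (@adj (spider k.+1)) i ord0.
    have [m] := ubnP (i : nat); elim: m i => // m IHm i lt_im.
    have [i0|i_gt0] := posnP i.
      by rewrite (_ : i = ord0) ?connect0 //; apply: val_inj.
    pose j : spider k.+1 := inord (if odd i then 0 else i.-1).
    have jE : (j : nat) = if odd i then 0 else i.-1.
      by rewrite inordK //; have := ltn_ord i; case: ifP; lia.
    apply: (@connect_trans _ _ j).
      by apply: connect1; rewrite /= /spider_adj /spider_parent i_gt0 jE eqxx.
    by apply: IHm; rewrite jE; case: ifP; lia.
  move=> i j; apply: connect_trans (to_root i) _.
  by rewrite (sym_connect_sym (@adj_sym _)).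
- apply: (@acyclic_of_unique_lower_neighbour (spider k.+1) (@nat_of_ord _)) => i j l /=.
  rewrite /spider_adj /spider_parent => ij il le_j le_l; apply: val_inj => /=.
  by move: ij il le_j le_l; case: ifP; case: ifP; case: ifP; lia.
Qed.

(** * Induced copies *)

Lemma induced_copy (H G : sgraph) (g : H -> G) :
    injective g -> (forall x y, adj (g x) (g y) = adj x y) ->
  graph_iso (induced_subgraph [set g x | x in [set: H]]) H.
Proof.
move=> g_inj g_adj; set S := [set _ | _ in _].
have gS x : g x \in S by rewrite imset_f ?inE.
pose g' x : induced_subgraph S := exist (fun y => y \in S) (g x) (gS x).
have pre (y : induced_subgraph S) : {x | g x == val y}.
  by apply/sigW; have /imsetP[x _ ->] := valP y; exists x.
pose f y := sval (pre y).
have fK : cancel f g'.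
  by move=> y; apply: val_inj; apply/eqP; exact: (svalP (pre y)).
have gK : cancel g' f.
  by move=> x; apply: g_inj; apply/eqP; exact: (svalP (pre (g' x))).
exists f; split; first by exists g'.
by move=> x y; rewrite -g_adj -[in RHS](fK x) -[in RHS](fK y).
Qed.

Lemma embedding_of_copy (H G : sgraph) (S : {set G}) :
    graph_iso (induced_subgraph S) H ->
  exists g : H -> G, [/\ injective g, (forall x, g x \in S) &
    forall x y, adj (g x) (g y) = adj x y].
Proof.
move=> [f [[g fK gK] f_adj]]; exists (fun x => val (g x)); split.
- by move=> x y /val_inj /(can_inj gK).
- by move=> x; exact: valP.
- by move=> x y; rewrite -[in RHS](gK x) -[in RHS](gK y) f_adj.
Qed.

(** * The point-line incidence graph arrows the spider *)

Section AffinePlane.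
Variable F : finFieldType.

Definition incident (P L : F * F) : bool := (P.2 == L.1 * P.1 + L.2)%R.

Definition plane_adj : rel (F * F + F * F)%type := fun u v =>
  match u, v with
  | inl P, inr L | inr L, inl P => incident P L
  | _, _ => false
  end.

Lemma plane_sym : symmetric plane_adj.
Proof. by move=> [u|u] [v|v]. Qed.

Lemma plane_irrefl : irreflexive plane_adj.
Proof. by move=> []. Qed.

Definition affine_plane : sgraph := SGraph plane_sym plane_irrefl.

Lemma unique_line (P Q L L' : F * F) :
  incident P L -> incident P L' -> incident Q L -> incident Q L' ->
  P != Q -> L = L'.
Proof.
case: P Q L L' => [x y] [x' y'] [a b] [a' b']; rewrite /incident /=.
move=> /eqP -> /eqP e1 /eqP -> /eqP e2 PQ.
have x_neq : (x - x' != 0)%R.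
  by apply: contra PQ => /eqP/subr0_eq ->.
have e : ((a - a') * (x - x') = 0)%R.
  have -> : ((a - a') * (x - x') = (a * x + b) - (a' * x + b') - ((a * x' + b) - (a' * x' + b')))%R.
    by ring.
  by rewrite e1 e2 !subrr.
move/eqP: e; rewrite mulf_eq0 (negPf x_neq) orbF subr_eq0 => /eqP aa'.
by move: e1; rewrite aa' => /addrI ->.
Qed.

Lemma card_line (L : F * F) : #|[set P | incident P L]| = #|F|.
Proof.
have inj : injective (fun x : F => (x, L.1 * x + L.2)%R) by move=> x y [].
rewrite -[RHS](card_imset predT inj); apply: eq_card => -[x y].
rewrite inE /incident /=; apply/eqP/imsetP => [->|[z _ [-> ->]] //].
by exists x.
Qed.

(** Each line has a colour shared by at least half of its points.  One of the two
    colours is that of at least half of the lines, so that, counting incidences,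
    some point lies on at least |F| / 4 of these lines in their own colour. *)
Lemma rich_point (col : F * F -> F * F -> bool) h :
    2 < #|F| -> 4 * h <= #|F| -> 
  exists (b : bool) (P : F * F) (A : {set F * F}), h <= #|A| /\
    forall L, L \in A -> [/\ incident P L, col P L = b &
      exists Q, [/\ Q != P, incident Q L & col Q L = b]].
Proof.
move=> F_gt2 h_le; pose p := #|F|.
pose pts b L := [set P | incident P L & col P L == b].
pose rich b := [set L | p <= 2 * #|pts b L|].
have split_line L : #|pts true L| + #|pts false L| = p.
  rewrite -[p](card_line L) -(cardsID [set P | col P L] [set P | incident P L]); congr (_ + _).
    by apply: eq_card => P; rewrite !inE eqb_id.
  by apply: eq_card => P; rewrite !inE eqbF_neg andbC.
have [b richb] : exists b, p ^ 2 <= 2 * #|rich b|.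
  have : p ^ 2 <= #|rich true| + #|rich false|.
    rewrite -mulnn -card_prod (leq_trans _ (leq_card_setU _ _)) //.
    rewrite -cardsT subset_leq_card //; apply/subsetP => L _.
    by rewrite !inE; have := split_line L; lia.
  move=> le; have [le'|lt'] := leqP (p ^ 2) (2 * #|rich true|); first by exists true.
  by exists false; lia.
pose lines P := [set L in rich b | incident P L && (col P L == b)].
have [P hP] : exists P, h <= #|lines P|.
  apply/existsP; apply: contraT; rewrite negb_exists => /forallP few.
  have count : \sum_P #|lines P| = \sum_(L in rich b) #|pts b L|.
    transitivity (\sum_P \sum_(L in rich b | P \in pts b L) 1).
      by apply: eq_bigr => P _; rewrite -sum1_card; apply: eq_bigl => L; rewrite !inE.
    rewrite (exchange_big_dep (mem (rich b))) => [|P L _ /andP[] //] /=.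
    by apply: eq_bigr => L Lb; rewrite -sum1_card; apply: eq_bigl => P; rewrite !inE; move: Lb; rewrite inE => ->.
  have low : #|rich b| * p <= 2 * \sum_(L in rich b) #|pts b L|.
    rewrite -sum_nat_const big_distrr; apply: leq_sum => L /=.
    by rewrite inE.
  have high : \sum_P #|lines P| <= p ^ 2 * h.-1.
    rewrite -mulnn -card_prod -sum_nat_const; apply: leq_sum => P _.
    by have := few P; lia.
  have p_gt0 : 0 < p ^ 3 by rewrite expn_gt0; apply/orP; left; rewrite /p; lia.
  have h_gt0 : 0 < h by have /= := few (0, 0)%R; lia.
  have : p ^ 3 <= p ^ 2 * (4 * h.-1).
    have := leq_mul richb (leqnn p); rewrite -expnSr.
    move: count low high; nia.
  have : p ^ 2 * (4 * h.-1) < p ^ 3.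
    rewrite (expnSr p 2) ltn_pmul2l ?expn_gt0; rewrite /p; lia.
  lia.
exists b, P, (lines P); split => // L; rewrite !inE => /and3P[Lrich PL /eqP colP].
split => //; have /card_gt1P[Q1 [Q2 [+ + Q12]]] : 1 < #|pts b L| by rewrite /p in Lrich; lia.
rewrite !inE => /andP[Q1L /eqP c1] /andP[Q2L /eqP c2].
have [eQ|Q1P] := eqVneq Q1 P; last by exists Q1.
by exists Q2; rewrite -eQ eq_sym.
Qed.

(** The spider has the point P of [rich_point] as centre, lines of A as inner
    vertices and second points on them as leaves.  It is induced because a
    second point of one leg on the line of another would give two points on two
    common lines. *)
Lemma plane_arrows_spider k : 2 < #|F| -> 2 * k <= #|F| ->
  induced_arrows affine_plane (spider k).
Proof.
move=> F_gt2 k_le col.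
pose colPL (P L : F * F) := col [set (inl P : affine_plane); inr L].
have h_le : 4 * k./2 <= #|F| by lia.
have [b [P [A [hA goodA]]]] := rich_point colPL F_gt2 h_le.
have PA L : L \in A -> incident P L by move=> /goodA[].
have cA L : L \in A -> colPL P L = b by move=> /goodA[].
have /choice[second secondP] : forall L, exists Q, L \in A ->
    [/\ Q != P, incident Q L & colPL Q L = b].
  move=> L; have [LA|] := boolP (L \in A); last by exists P.
  by have [_ _ [Q HQ]] := goodA L LA; exists Q.
pose line j := nth (0, 0)%R (enum A) j.
have lineA j : j < k./2 -> line j \in A.
  by move=> lt_j; rewrite -mem_enum mem_nth // -cardE (leq_trans lt_j).
have line_inj i j : i < k./2 -> j < k./2 -> line i = line j -> i = j.
  move=> lt_i lt_j /eqP; rewrite nth_uniq ?enum_uniq -?cardE ?(leq_trans _ hA) //.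
  by move/eqP.
have second_line i j : i < k./2 -> j < k./2 ->
    incident (second (line j)) (line i) -> i = j.
  move=> lt_i lt_j inc; apply: line_inj => //.
  have [neP inc' _] := secondP _ (lineA _ lt_j).
  exact: unique_line inc inc' (PA _ (lineA _ lt_i)) (PA _ (lineA _ lt_j)) neP.
pose leg (i : nat) := i.-1./2.
have leg_lt (i : 'I_k) : 0 < i -> leg i < k./2 by have := ltn_ord i; rewrite /leg; lia.
pose g (i : 'I_k) : affine_plane :=
  if i == 0 :> nat then inl P
  else if odd i then inr (line (leg i)) else inl (second (line (leg i))).
have g_adj (i j : 'I_k) : adj (g i) (g j) = spider_adj i j.
  (* Odd vertices go to lines and even ones to points, so the parities decide. *)
  wlog: i j / (odd j <= odd i) => [sym|].
    by case: (leqP (odd j) (odd i)) => [/sym //|/ltnW/sym]; rewrite adj_sym => ->; rewrite spider_sym.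
  rewrite /= /spider_adj /spider_parent /g.
  have [i0|i_gt0] := posnP i; have [j0|j_gt0] := posnP j.
  - by rewrite i0 j0.
  - by rewrite i0 /=; case odd_j: (odd j) => //= _; lia.
  - rewrite j0 /=; case odd_i : (odd i) => /= _; last by lia.
    by rewrite PA ?lineA ?leg_lt.
  case odd_i : (odd i); case odd_j : (odd j) => //= _; [lia| |lia].
  have [eq_leg|ne_leg] := eqVneq (leg i) (leg j).
    have [_ -> _] : [/\ second (line (leg j)) != P, incident (second (line (leg j))) (line (leg i)) & true].
      by rewrite eq_leg; have [-> ->] := secondP _ (lineA _ (leg_lt j j_gt0)).
    by move: eq_leg; rewrite /leg; lia.
  apply/idP/idP => [inc|]; first by case/eqP: ne_leg; apply: second_line; rewrite ?leg_lt.
  by move: ne_leg; rewrite /leg; lia.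
have g_inj : injective g.
  move=> i j; rewrite /g => eq_g; apply: val_inj => /=; move: eq_g.
  have [i0|i_gt0] := posnP i; have [j0|j_gt0] := posnP j; first by rewrite i0 j0.
  - case: ifP => // _ [] eP; have [/negP[]] := secondP _ (lineA _ (leg_lt j j_gt0)).
    by rewrite -eP.
  - case: ifP => // _ [] eP; have [/negP[]] := secondP _ (lineA _ (leg_lt i i_gt0)).
    by rewrite eP.
  case: ifP; case: ifP => // odd_j odd_i [].
    by move/line_inj; rewrite /leg => /(_ (leg_lt i i_gt0) (leg_lt j j_gt0)); rewrite /leg; lia.
  move=> eq_sec; suff: leg i = leg j by rewrite /leg; lia.
  apply: second_line; rewrite ?leg_lt // -eq_sec.
  by have [_ ->] := secondP _ (lineA _ (leg_lt i i_gt0)).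
have g_col (i j : 'I_k) : ~~ odd i -> odd j -> adj (g i) (g j) -> col [set g i; g j] = b.
  rewrite /g => /negPf -> odd_j; have j_gt0 : 0 < j by case: (j : nat) odd_j.
  rewrite odd_j (negPf (lt0n_neq0 j_gt0)).
  have [i0|i_gt0] := posnP i; first by rewrite /= => _; apply: cA; rewrite lineA ?leg_lt.
  move=> /second_line-> //; rewrite ?leg_lt //.
  by have [_ _] := secondP _ (lineA _ (leg_lt i i_gt0)).
exists [set g x | x in [set: spider k]]; split; first exact: (@induced_copy (spider k) affine_plane g g_inj g_adj).
exists b => _ _ /imsetP[i _ ->] /imsetP[j _ ->] ij.
have : odd i != odd j.
  move: ij; rewrite g_adj /= /spider_adj /spider_parent.
  by case odd_i: (odd i); case odd_j: (odd j); lia.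
case odd_i: (odd i); case odd_j: (odd j) => // _.
  by rewrite setUC g_col // ?odd_j // adj_sym.
by rewrite g_col // odd_i.
Qed.
End AffinePlane.

Lemma exists_induced_ramsey_graph k : exists G : sgraph, induced_arrows G (spider k).
Proof.
have [p p_gt p_pr] := prime_above (2 * k).+2.
exists (affine_plane 'F_p).
by apply: plane_arrows_spider; rewrite card_Fp //; lia.
Qed.

Lemma exists_induced_ramsey_number (H : sgraph) :
  (exists G : sgraph, induced_arrows G H) -> exists r, is_induced_ramsey_number H r.
Proof.
move=> [G0 arr0].
have ex : exists r, `[< exists G : sgraph, #|G| = r /\ induced_arrows G H >].
  by exists #|G0|; apply/asboolP; exists G0.
case: (ex_minnP ex) => r /asboolP Hr r_min; exists r; split => // G arr.
by apply: r_min; apply/asboolP; exists G.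
Qed.

(** * Partitions in which few pairs of cells are irregular *)

Lemma card_fibres (A B : finType) (g : A -> B) (S : {set A}) :
  #|S| = \sum_b #|[set x in S | g x == b]|.
Proof.
rewrite -sum1_card (partition_big g predT) //=; apply: eq_bigr => b _.
by rewrite -sum1_card; apply: eq_bigl => x; rewrite inE.
Qed.

Section Partition.
Variables (G : sgraph) (q : nat).

(** Isolated vertices are allowed, so that all vertices of a spider but its centre
    qualify. *)
Definition induced_matching (U : {set G}) : bool :=
  [forall x in U, forall y in U, forall z in U, adj x y ==> adj x z ==> (y == z)].

Definition cell (L : finType) (f : G -> L) (a : L) : {set G} := [set x | f x == a].

(** The lower bound by an absolute constant serves the estimate of the number of
    edges: a matching in a rectangle is sparse only if the sides are long. *)
Definition thick (L : finType) (f : G -> L) (U : {set G}) (a : L) : bool :=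
  (#|cell f a| <= q * #|U :&: cell f a|) && (q <= #|U :&: cell f a|).

Definition witness (L : finType) (f : G -> L) (ab : L * L) (U : {set G}) : bool :=
  [&& induced_matching U, thick f U ab.1 & thick f U ab.2].

(** The product of cells that contains a pair. *)
Definition label2 (L : finType) (f : G -> L) (xy : G * G) : L * L := (f xy.1, f xy.2).

Definition irregular (L : finType) (f : G -> L) (W : {set G * G}) : {set G * G} :=
  [set xy | (xy \notin W) && [exists U, witness f (label2 f xy) U]].

Definition edges_in (W : {set G * G}) : {set G * G} :=
  [set xy in W | adj xy.1 xy.2].

Definition saturated (L : finType) (f : G -> L) (W : {set G * G}) : Prop :=
  forall u v, label2 f u = label2 f v -> u \in W -> v \in W.

Definition sparse (W : {set G * G}) : Prop := q * #|edges_in W| <= #|W|.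

(** Every vertex of A has at most one neighbour in B. *)
Lemma sparse_matching_rectangle (U A B : {set G}) :
    induced_matching U -> A \subset U -> B \subset U -> q <= #|B| ->
  sparse (setX A B).
Proof.
move=> /forall_inP matU /subsetP AU /subsetP BU qB; rewrite /sparse cardsX mulnC.
apply: leq_mul => //.
have fst_inj : {in edges_in (setX A B) &, injective fst}.
  move=> [x y] [x' z]; rewrite !inE /= => /andP[/andP[xA yB] xy] /andP[/andP[_ zB] xz] eqx.
  move: xz; rewrite -{}eqx => xz; congr (_, _); apply/eqP.
  move/forall_inP: (matU _ (AU _ xA)) => /(_ _ (BU _ yB)) /forall_inP.
  by move=> /(_ _ (BU _ zB)); rewrite xy xz.
rewrite -(card_in_imset fst_inj); apply/subset_leq_card/subsetP => _ /imsetP[[x y] + ->].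
by rewrite !inE /= => /andP[/andP[]].
Qed.

(** The new W' adds to W, for each irregular product of cells, its part in U x U
    for a witness U: at least 1 / q ^ 2 of the product, and sparse as G[U] is a
    matching.  Labelling x by its membership in all chosen U makes W' a union of
    products of cells, and bounds the number of new labels in terms of the old. *)
Lemma refine (L : finType) (f : G -> L) (W : {set G * G}) :
    saturated f W -> sparse W ->
  exists (f' : G -> L * {ffun L * L -> bool}) (W' : {set G * G}),
  [/\ saturated f' W', sparse W' &
      q ^ 2 * #|W| + #|irregular f W| <= q ^ 2 * #|W'|].
Proof.
move=> satW spW.
pose U ab := odflt set0 [pick U | witness f ab U].
pose f' x := (f x, [ffun ab => x \in U ab]).
pose R := [set xy in irregular f W |
  (xy.1 \in U (label2 f xy)) && (xy.2 \in U (label2 f xy))].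
have U_wit u : u \in irregular f W -> witness f (label2 f u) (U (label2 f u)).
  rewrite inE => /andP[_ /existsP[V wV]]; rewrite /U.
  by case: pickP => [|/(_ V)] //=; rewrite wV.
have irrE u v : label2 f u = label2 f v -> u \in irregular f W -> v \in irregular f W.
  move=> uv; rewrite !inE uv => /andP[uW ->]; rewrite andbT.
  by apply: contra uW; apply: satW.
have fibre_R u : u \in irregular f W ->
    let ab := label2 f u in
    [set v in R | label2 f v == ab] =
      setX (U ab :&: cell f ab.1) (U ab :&: cell f ab.2).
  move=> u_irr ab; apply/setP => -[v1 v2].
  rewrite in_setX [LHS]inE [_ \in R]inE !in_setI; set v := (v1, v2).
  rewrite ![_ \in cell _ _]inE.
  have [/eqP vab|] := boolP (label2 f v == ab); last first.
    by rewrite andbF /label2 xpair_eqE negb_and => /orP[] /negPf->; rewrite ?andbF.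
  by rewrite (irrE u v) // vab -vab /= !eqxx !andbT.
have fibre0 ab : (forall u, u \in irregular f W -> label2 f u != ab) ->
    [set v in irregular f W | label2 f v == ab] = set0.
  move=> no_u; apply/eqP; rewrite -subset0; apply/subsetP => v.
  by rewrite in_set => /andP[/no_u/negPf->].
have fibreR0 ab : (forall u, u \in irregular f W -> label2 f u != ab) ->
    [set v in R | label2 f v == ab] = set0.
  move=> no_u; apply/eqP; rewrite -subset0; apply/subsetP => v.
  by rewrite in_set => /andP[]; rewrite in_set => /andP[/no_u/negPf->].
have cellP ab : (exists2 u, u \in irregular f W & label2 f u = ab) \/
    (forall u, u \in irregular f W -> label2 f u != ab).
  have [/exists_inP[u u_irr /eqP]|] :=
    boolP [exists u in irregular f W, label2 f u == ab]; first by left; exists u.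
  by rewrite negb_exists_in => /forall_inP; right.
have spR : sparse R.
  rewrite /sparse (card_fibres (label2 f) R) (card_fibres (label2 f) (edges_in R)).
  rewrite big_distrr; apply: leq_sum => ab _ /=.
  have -> : [set x in edges_in R | label2 f x == ab] = edges_in [set x in R | label2 f x == ab].
    by apply/setP => v; rewrite !inE /= -!andbA; do !bool_congr.
  have [[u u_irr <-]|/fibreR0 ->] := cellP ab.
    rewrite fibre_R //=; have /and3P[matU _ /andP[_ qb]] := U_wit _ u_irr.
    by apply: sparse_matching_rectangle matU _ _ qb; apply: subsetIl.
  have -> : edges_in set0 = set0 by apply/setP => v; rewrite !inE.
  by rewrite cards0 muln0.
have card_irr : #|irregular f W| <= q ^ 2 * #|R|.
  rewrite (card_fibres (label2 f) R) (card_fibres (label2 f) (irregular f W)).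
  rewrite big_distrr; apply: leq_sum => ab _ /=.
  have [[u u_irr <-]|/fibre0 ->] := cellP ab; last by rewrite cards0.
  rewrite fibre_R // cardsX.
  have /and3P[_ /andP[le_a _] /andP[le_b _]] := U_wit _ u_irr.
  apply: (@leq_trans #|setX (cell f (label2 f u).1) (cell f (label2 f u).2)|).
    apply/subset_leq_card/subsetP => -[v1 v2]; rewrite inE => /andP[_ /eqP <-].
    by rewrite in_setX !inE !eqxx.
  by rewrite cardsX (leq_trans (leq_mul le_a le_b)) // mulnACA mulnn.
have disj : [disjoint W & R].
  apply/pred0P => u /=; rewrite [u \in R]inE [u \in irregular _ _]inE.
  by case: (u \in W).
have cardWR : #|W :|: R| = #|W| + #|R| by apply/eqP; rewrite (leq_card_setU W R).
have edgesWR : edges_in (W :|: R) = edges_in W :|: edges_in R.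
  by apply/setP => u; rewrite !in_setU [LHS]inE in_setU 2![_ \in edges_in _]inE andb_orl.
exists f', (W :|: R); split.
- move=> [x y] [x' y'] /= []; rewrite /label2 /= => ex /ffunP eUx ey /ffunP eUy.
  have exy : label2 f (x, y) = label2 f (x', y') by rewrite /label2 /= ex ey.
  rewrite !in_setU => /orP[/(satW _ _ exy) -> //|]; rewrite orbC.
  rewrite [_ \in R]inE => /and3P[xy_irr /= xU yU]; rewrite [_ \in R]inE (irrE _ _ exy) //=.
  move: (eUx (label2 f (x, y))) (eUy (label2 f (x, y))); rewrite !ffunE -exy => <- <-.
  by rewrite xU yU.
- rewrite /sparse cardWR edgesWR (leq_trans (leq_mul (leqnn q) (leq_card_setU _ _))) //.
  by rewrite mulnDr leq_add.
- by rewrite cardWR mulnDr leq_add2l.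
Qed.
End Partition.

(** By [refine], every round that does not succeed adds at least n ^ 2 / q ^ 3
    pairs to W.  The bound M precedes G: the number of labels after s rounds
    depends on s alone. *)
Lemma regular_partition_or_large (q s : nat) :
  exists M, forall G : sgraph, exists (L : finType) (f : G -> L) (W : {set G * G}),
  [/\ #|L| <= M, saturated f W, sparse q W &
      q * #|irregular q f W| <= #|G| ^ 2 \/ s * #|G| ^ 2 <= q ^ 3 * #|W| ].
Proof.
elim: s => [|s [M IHs]].
  exists 1 => G; exists unit, (fun=> tt), set0; split; rewrite ?card_unit //; last by right.
    by move=> u v _; rewrite inE.
  have e0 : edges_in (set0 : {set G * G}) = set0 by apply/setP => u; rewrite !inE.
  by rewrite /sparse e0 !cards0 muln0.
exists (M * 2 ^ (M * M)) => G; have [L [f [W [leM satW spW alt]]]] := IHs G.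
have [small|large] := leqP (q * #|irregular q f W|) (#|G| ^ 2).
  exists L, f, W; split => //; last by left.
  by rewrite (leq_trans leM) // leq_pmulr // expn_gt0.
have {alt} alt : s * #|G| ^ 2 <= q ^ 3 * #|W|.
  by case: alt => //; rewrite leqNgt large.
have [f' [W' [satW' spW' grow]]] := refine satW spW.
exists (L * {ffun L * L -> bool})%type, f', W'; split => //.
  rewrite card_prod card_ffun card_bool card_prod leq_mul // leq_exp2l //.
  exact: leq_mul.
right; rewrite mulSn; rewrite !expnSr !expn0 mul1n in alt grow large *.
by move: alt (leq_mul (leqnn q) grow) large; nia.
Qed.

Lemma regular_partition (q : nat) :
  exists M, forall G : sgraph, exists (L : finType) (f : G -> L) (W : {set G * G}),
  [/\ #|L| <= M, saturated f W, sparse q W &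
      q * #|irregular q f W| <= #|G| ^ 2 ].
Proof.
have [M part] := regular_partition_or_large q (q ^ 3).+1.
exists M => G; have [L [f [W [leM satW spW alt]]]] := part G.
exists L, f, W; split => //; case: alt => // big.
have leW (V : {set G * G}) : #|V| <= #|G| ^ 2 by rewrite -mulnn -card_prod max_card.
have G0 : #|G| ^ 2 = 0.
  have := leq_mul (leqnn (q ^ 3)) (leW W); move: big; rewrite mulSn; lia.
by have := leW (irregular q f W); rewrite G0 leqn0 => /eqP ->; rewrite muln0.
Qed.

(** * The colouring without monochromatic induced spiders *)

Section Colouring.
Variables (G : sgraph) (q h : nat) (L : finType) (f : G -> L) (W : {set G * G}).

(** The set B of the proof idea, as ordered pairs. *)
Definition exceptional : {set G * G} := edges_in (W :|: irregular q f W).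

Definition exceptional_adj : rel G :=
  fun x y => ((x, y) \in exceptional) || ((y, x) \in exceptional).

Definition heavy : {set G} := [set x | h <= #|[set y | exceptional_adj x y]|].

Definition light_exceptional : rel G :=
  fun x y => [&& x \notin heavy, y \notin heavy & exceptional_adj x y].

Definition colouring (e : {set G}) : bool :=
  [exists x in e, exists y in e, light_exceptional x y].

Lemma exceptional_adj_sym : symmetric exceptional_adj.
Proof. by move=> x y; rewrite /exceptional_adj orbC. Qed.

Lemma exceptional_adj_irrefl : irreflexive exceptional_adj.
Proof. by move=> x; rewrite /exceptional_adj orbb inE /= adj_irrefl andbF. Qed.

Lemma colouringE x y : colouring [set x; y] = light_exceptional x y.
Proof.
apply/exists_inP/idP => [[u + /exists_inP[v]]|xy].
  rewrite !inE => /pred2P uxy /pred2P vxy.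
  case: uxy vxy => -> [] ->; rewrite /light_exceptional ?exceptional_adj_irrefl ?andbF //.
  by rewrite exceptional_adj_sym => /and3P[-> -> ->].
exists x; first by rewrite !inE eqxx.
by apply/exists_inP; exists y; rewrite // !inE eqxx orbT.
Qed.

Lemma card_exceptional : sparse q W -> q * #|irregular q f W| <= #|G| ^ 2 ->
  q * #|exceptional| <= 2 * #|G| ^ 2.
Proof.
move=> spW irr_le; have leW : #|W| <= #|G| ^ 2 by rewrite -mulnn -card_prod max_card.
have : #|exceptional| <= #|edges_in W| + #|irregular q f W|.
  apply: leq_trans (leq_card_setU _ _); apply/subset_leq_card/subsetP => u.
  by rewrite 2!inE in_setU [_ \in edges_in W]inE => /andP[/orP[]-> ->] //; rewrite orbT.
by move/(leq_mul (leqnn q)); move: spW; rewrite /sparse mulnDr; lia.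
Qed.

Lemma card_heavy : h * #|heavy| <= 2 * #|exceptional|.
Proof.
have -> : 2 * #|exceptional| = \sum_x (#|[set u in exceptional | u.1 == x]| + #|[set u in exceptional | u.2 == x]|).
  by rewrite big_split /= -!card_fibres addnn mul2n.
rewrite mulnC -sum_nat_const big_mkcond /=; apply: leq_sum => x _.
case: ifP => //; rewrite inE => /leq_trans; apply.
have pair_inj : injective (pair x : G -> G * G) by move=> y z [].
have pair_inj' : injective (fun y => (y, x) : G * G) by move=> y z [].
have -> : [set y | exceptional_adj x y] =
    [set y | (x, y) \in exceptional] :|: [set y | (y, x) \in exceptional].
  apply/setP => y; apply: etrans (in_set _ _) _; rewrite in_setU.
  by congr (_ || _); rewrite in_set.
apply: leq_trans (leq_card_setU _ _) _.
rewrite -(card_imset [set y | (x, y) \in exceptional] pair_inj)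
        -(card_imset [set y | (y, x) \in exceptional] pair_inj').
apply: leq_add; apply/subset_leq_card/subsetP => _ /imsetP[y + ->]; rewrite [in X in X -> _]in_set => ye;
  by rewrite in_set ye /=.
Qed.

(** The vertices of U lost when U is cleaned with respect to the cells. *)
Definition thin_part (U : {set G}) : {set G} := [set x in U | ~~ thick q f U (f x)].

(** A cell a where U is thin contains fewer than |a| / q or fewer than q vertices
    of U; sum over the cells. *)
Lemma card_thin_part (U : {set G}) :
  q * #|thin_part U| <= #|G| + q ^ 2 * #|L|.
Proof.
rewrite (card_fibres f) big_distrr /=.
have -> : #|G| = \sum_a #|cell f a|.
  rewrite -cardsT (card_fibres f); apply: eq_bigr => a _.
  by apply: eq_card => x; rewrite !inE.
rewrite mulnC -sum_nat_const -big_split /=.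
apply: leq_sum => a _; have [thick_a|] := boolP (thick q f U a).
  rewrite [X in #|pred_of_set X|](_ : _ = set0) ?cards0 ?muln0 //.
  apply/setP => x; rewrite [LHS]inE [_ \in thin_part U]inE inE.
  by apply/negbTE/negP => /andP[/andP[_ /negP nt] /eqP fxa]; rewrite fxa in nt.
have : #|[set x in thin_part U | f x == a]| <= #|U :&: cell f a|.
  apply/subset_leq_card/subsetP => x; rewrite inE [_ \in thin_part U]inE !inE.
  by move=> /andP[/andP[-> _] ->].
by rewrite negb_and -!ltnNge => le_t /orP[] lt; have := leq_mul (leqnn q) le_t; rewrite -?mulnn; nia.
Qed.

(** The product of the cells of x and y, if disjoint from W, is irregular, with U
    itself as witness; so the edge is exceptional in any case. *)
Lemma thick_edge_coloured (U : {set G}) x y :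
    saturated f W -> induced_matching U -> x \in U -> y \in U -> adj x y ->
    x \notin heavy -> y \notin heavy ->
    x \notin thin_part U -> y \notin thin_part U ->
  colouring [set x; y] = true.
Proof.
move=> satW matU xU yU xy xh yh; rewrite ![_ \in thin_part U]inE xU yU !negbK => thx thy.
rewrite colouringE /light_exceptional xh yh /= /exceptional_adj.
apply/orP; left; rewrite !inE /= xy andbT.
case: (boolP ((x, y) \in W)) => //= _; apply/existsP; exists U.
by rewrite /witness matU thx thy.
Qed.

(** In the colour true, the centre of the spider would be heavy.  In the colour
    false, some leg avoids the few heavy or thin vertices, and its outer edge
    contradicts [thick_edge_coloured]. *)
Lemma colouring_no_spider k (S : {set G}) :
    saturated f W -> h = k./2 -> 0 < h ->
    (forall U : {set G}, #|heavy| + #|thin_part U| < k.-1./2) ->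
    graph_iso (induced_subgraph S) (spider k) -> ~ monochromatic_on colouring S.
Proof.
move=> satW hE h_gt0 few /embedding_of_copy[g [g_inj gS g_adj]] [b mono].
have k_gt1 : 1 < k by lia.
have mono_g i j : adj i j -> colouring [set g i; g j] = b.
  by move=> ij; apply: mono; rewrite ?gS // g_adj.
have k_gt0 : 0 < k by lia.
pose pt (i : nat) : spider k := insubd (Ordinal k_gt0) i.
have ptE i : i < k -> pt i = i :> nat by move=> lt_ik; rewrite /pt val_insubd lt_ik.
pose odd_pt (i : nat) := pt i.*2.+1.
pose even_pt (i : nat) := pt i.*2.+2.
case: b mono mono_g => _ mono_g.
  have odd_lt (i : 'I_h) : i.*2.+1 < k by have := ltn_ord i; lia.
  have centre_odd (i : 'I_h) : adj (pt 0) (odd_pt i).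
    by rewrite /= /spider_adj /spider_parent /odd_pt !ptE //= odd_double.
  have light (i : 'I_h) : light_exceptional (g (pt 0)) (g (odd_pt i)).
    by rewrite -colouringE mono_g.
  have /and3P[/negP not_heavy _ _] := light (Ordinal h_gt0); case: not_heavy.
  rewrite inE -[X in X <= _]card_ord.
  have A_inj : injective (fun i : 'I_h => g (odd_pt i)).
    move=> i j /g_inj/(congr1 (@nat_of_ord _)); rewrite /odd_pt !ptE // => e.
    by apply: val_inj => /=; lia.
  rewrite -(card_imset predT A_inj); apply/subset_leq_card/subsetP => _ /imsetP[i _ ->].
  by rewrite inE; have /and3P[_ _] := light i.
pose U := [set g i | i : spider k & 0 < i].
have matU : induced_matching U.
  apply/forall_inP => _ /imsetP[i + ->]; rewrite inE => i0.
  apply/forall_inP => _ /imsetP[j + ->]; rewrite inE => j0.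
  apply/forall_inP => _ /imsetP[l + ->]; rewrite inE => l0.
  rewrite !g_adj; apply/implyP => ij; apply/implyP => il; apply/eqP; congr g; apply: val_inj => /=.
  move: ij il; rewrite /= /spider_adj /spider_parent.
  by case: ifP; case: ifP; case: ifP; lia.
pose bad := heavy :|: thin_part U.
have odd_lt (i : 'I_(k.-1./2)) : i.*2.+1 < k by have := ltn_ord i; lia.
have even_lt (i : 'I_(k.-1./2)) : i.*2.+2 < k by have := ltn_ord i; lia.
have oddU (i : 'I_(k.-1./2)) : g (odd_pt i) \in U by apply: imset_f; rewrite inE /odd_pt ptE.
have evenU (i : 'I_(k.-1./2)) : g (even_pt i) \in U by apply: imset_f; rewrite inE /even_pt ptE.
have [i odd_ok even_ok] : exists2 i : 'I_(k.-1./2), g (odd_pt i) \notin bad & g (even_pt i) \notin bad.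
  apply/exists_inP; apply: contraT; rewrite negb_exists_in => /forall_inP all_bad.
  (* Legs are disjoint, so a bad vertex in every leg would give too many. *)
  pose pick_bad (i : 'I_(k.-1./2)) := if g (odd_pt i) \in bad then g (odd_pt i) else g (even_pt i).
  have pick_inj : injective pick_bad.
    move=> i j; rewrite /pick_bad; case: ifP => _; case: ifP => _ /g_inj/(congr1 (@nat_of_ord _));
      rewrite /odd_pt /even_pt !ptE // => e; apply: val_inj => /=; lia.
  have : #|'I_(k.-1./2)| <= #|bad|.
    rewrite -(card_imset predT pick_inj); apply/subset_leq_card/subsetP => _ /imsetP[i _ ->].
    by rewrite /pick_bad; case: ifP => // odd_ok; have := all_bad i; rewrite odd_ok negbK; apply.
  by rewrite card_ord leqNgt (leq_ltn_trans (leq_card_setU _ _)).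
move: odd_ok even_ok; rewrite !in_setU !negb_or => /andP[oh ot] /andP[eh et].
have adj_oe : adj (odd_pt i) (even_pt i).
  by rewrite /= /spider_adj /spider_parent /odd_pt /even_pt !ptE //= odd_double eqxx !orbT.
have := @thick_edge_coloured U _ _ satW matU (oddU i) (evenU i) _ oh eh ot et.
by rewrite g_adj mono_g // => /(_ adj_oe).
Qed.
End Colouring.

Lemma spider_induced_ramsey_superlinear (C : nat) :
  exists k0, forall k, k0 <= k -> 0 < k /\ 
    forall G : sgraph, induced_arrows G (spider k) -> C * k <= #|G|.
Proof.
(* With |G| <= D k, the heavy vertices number at most 12 D ^ 2 k / q, and the thin
   ones at most D k / q + M q, together at most k / 8 + M q for this q,
   which is below the number of legs once k >= 16 M q + 100. *)
pose D := C.+1; pose q := 104 * D ^ 2.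
have [M part] := regular_partition q.
exists (16 * (M * q) + 100) => k k_ge; split; first lia.
move=> G arrows; rewrite leqNgt; apply/negP => small.
have [L [f [W [leM satW spW irr]]]] := part G.
have [S [isoS monoS]] := arrows (colouring q k./2 f W).
have D_gt0 : 0 < D by [].
apply: (colouring_no_spider satW erefl _ _ isoS monoS); first lia.
move=> U; have heavy_le := card_heavy q k./2 f W.
have exc_le := card_exceptional spW irr.
have thin_le := card_thin_part q f U.
set x := #|heavy _ _ _ _| in heavy_le *; set t := #|thin_part _ _ _| in thin_le *.
set e := #|exceptional _ _ _| in heavy_le exc_le.
have G_le : #|G| <= D * k by rewrite /D; nia.
have h_ge : k <= 3 * k./2 by lia.
have q_gt0 : 0 < q by rewrite /q; nia.
have qx : q * x <= 12 * D ^ 2 * k.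
  have G2_le : #|G| ^ 2 <= D ^ 2 * k ^ 2 by rewrite -expnMn leq_sqr.
  have : k * (q * x) <= k * (12 * D ^ 2 * k).
    have := leq_mul (leqnn (3 * q)) heavy_le.
    have := leq_mul h_ge (leqnn (q * x)).
    by move: exc_le G2_le; lia.
  by rewrite leq_pmul2l //; lia.
have qt : q * t <= D * k + q * (M * q).
  apply: leq_trans thin_le _; rewrite leq_add // -mulnn -mulnA leq_mul //.
  by rewrite mulnC leq_mul.
have D2 : D <= D ^ 2 by rewrite -mulnn leq_pmulr.
have : q * (8 * (x + t)) <= q * (k + 8 * (M * q)).
  have : D * k <= D ^ 2 * k by rewrite leq_mul.
  have : q * k = 104 * (D ^ 2 * k) by rewrite /q mulnA.
  by move: qx qt; lia.
by rewrite leq_pmul2l //; lia.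
Qed.

Local Open Scope ring_scope.

Theorem theorem1p7 (R : realType) (c : R) (hc : 0 < c) :
  exists k0 : nat, forall k : nat, (k0 <= k)%N ->
    exists T : sgraph, [/\ is_tree T, #|T| = k &
      exists r : nat, is_induced_ramsey_number T r /\ c * k%:R <= r%:R].
Proof.
have [k0 lower] := spider_induced_ramsey_superlinear (Num.bound c).
exists k0 => k /lower[k_gt0 {}lower]; exists (spider k).
split; [exact: spider_is_tree | exact: card_ord |].
have [r ramsey_r] := exists_induced_ramsey_number (exists_induced_ramsey_graph k).
exists r; split => //; have [[G [<- /lower le_G]] _] := ramsey_r.
apply: (@le_trans _ _ ((Num.bound c)%:R * k%:R)).
  by rewrite ler_wpM2r // ltW // archi_boundP // ltW.
by rewrite -natrM ler_nat.
Qed.
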